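(* Let $p(n)=p_n$ denote the number of partitions of $n$ (with $p(0)=1$) and let $T_n=\tau(n+1)$ for $n\ge0$. Then for every integer $n\ge1$, $$n\,p_n=\sum_{k=1}^{n}\frac{(-1)^k}{24}\,|H_k(\overline{T})|\,p(n-k).$$
   Context: $\tau$ is Ramanujan's tau function, defined by $\sum_{n\ge1}\tau(n)q^n=q\prod_{m\ge1}(1-q^m)^{24}$. $|M|$ denotes the determinant of a square matrix $M$. For a sequence $\overline{h}=(h_0,h_1,h_2,\dots)$ with $h_0=1$, $H_n(\overline{h})$ is the $n\times n$ matrix whose first column has entries $i\,h_i$ ($1\le i\le n$), whose $(i,k)$ entry is $h_{i-k+1}$ for $2\le k\le i$, is $1$ for $k=i+1$, and is $0$ for $k>i+1$. *)

(* Defs.v *)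
From mathcomp Require Import all_boot all_order all_algebra.

Set Implicit Arguments.
Unset Strict Implicit.
Unset Printing Implicit Defensive.

Import GRing.Theory.
Local Open Scope ring_scope.

(* The coefficient of q^n in q * \prod_(m >= 1) (1 - q^m)^24: the factors with
   m > n do not affect it, see tau_stable. *)
Definition tau (n : nat) : int :=
  ('X * \prod_(1 <= m < n.+1) (1 - 'X^m) ^+ 24 : {poly int})`_n.

Lemma tau_stable (n N : nat) : (n <= N)%N ->
  ('X * \prod_(1 <= m < N.+1) (1 - 'X^m) ^+ 24 : {poly int})`_n = tau n.
Proof.
elim: N => [|N IHN]; first by rewrite leqn0 => /eqP->.
rewrite leq_eqVlt => /predU1P[-> // | ltnN].
rewrite big_nat_recr //= -IHN // mulrA.
set P : {poly int} := 'X * _.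
have [Q ->] : exists Q : {poly int},
    (1 - 'X^(N.+1)) ^+ 24 = 1 + Q * 'X^(N.+1).
  elim: 24%N => [|j [Q IHQ]]; first by exists 0; rewrite mul0r addr0.
  exists (Q * (1 - 'X^(N.+1)) - 1).
  rewrite exprSr IHQ mulrDl mul1r mulrBl mul1r mulrAC -addrA; congr (_ + _).
  by rewrite addrC.
by rewrite mulrDr mulr1 mulrA coefD coefMXn ltnN addr0.
Qed.

Definition is_partition (n : nat) (s : seq nat) : bool :=
  [&& sorted geq s, 0%N \notin s & sumn s == n].

(* Partitions of n are counted by their number k of parts; a partition of n has
   at most n parts, all of them at most n, so no partition is missed. *)
Definition npartitions (n : nat) : nat :=
  (\sum_(k < n.+1)
     #|[set t : k.-tuple 'I_n.+1 | is_partition n (map val t)]|)%N.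

(* Row and column indices are 0-based here: the 1-based entry (i, k) is the
   entry (i - 1, k - 1) of this matrix. *)
Definition Hmx (R : nzRingType) (h : nat -> R) (n : nat) : 'M[R]_n :=
  \matrix_(i < n, k < n)
    if k == 0%N :> nat then i.+1%:R * h i.+1
    else if (k <= i)%N then h (i.+1 - k)%N
    else if k == i.+1 :> nat then 1
    else 0.

(* Main.v *)
Require Import Defs.
From mathcomp Require Import all_boot all_order all_algebra.
From mathcomp Require Import ring zify.

(** With [E = \prod_m (1 - q^m)], the partition series [A] satisfies
    [A E = 1], so [T = E^24] has logarithmic derivative
    [q T' / T = 24 q E' / E = - 24 q A' / A].  On the other hand
    [|H_k(h)|] is [(-1)^(k-1)] times the coefficient of [q^k] in the logarithmic
    derivative [q h' / h], because [H_k(h)] is the product of the unitriangular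
    Toeplitz matrix of [h] and a matrix whose determinant is evident.
    Comparing coefficients in [q A' = (q A' / A) A] gives the formula.  These
    identities of series are read modulo a power of ['X] in [{poly rat}]. *)

Set Implicit Arguments.
Unset Strict Implicit.
Unset Printing Implicit Defensive.

Import GRing.Theory Num.Theory.
Local Open Scope ring_scope.

(** * Evaluation of [\det (Hmx h n)] *)

Section Determinant.

Variable R : comNzRingType.
Implicit Types h d : nat -> R.

Definition toeplitz_mx h n : 'M[R]_n :=
  \matrix_(i < n, j < n) if (j <= i)%N then h (i - j)%N else 0.

Definition shift_mx d n : 'M[R]_n :=
  \matrix_(i < n, k < n)
    if k == 0%N :> nat then d i.+1 else (i.+1 == k :> nat)%:R.

Lemma det_toeplitz_mx h n : h 0%N = 1 -> \det (toeplitz_mx h n) = 1.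
Proof.
move=> h0; rewrite det_trig; last first.
  by apply/is_trig_mxP => i j lt_ij; rewrite mxE leqNgt lt_ij.
by rewrite big1 // => i _; rewrite mxE leqnn subnn.
Qed.

(** The last row has its superdiagonal [1] outside the matrix, so only its first entry survives, and
    the minor of that entry is the identity. *)
Lemma det_shift_mx d n : \det (shift_mx d n.+1) = (-1) ^+ n * d n.+1.
Proof.
rewrite (expand_det_row _ ord_max) big_ord_recl big1 => [|k _]; last first.
  rewrite mxE /= /bump /= !add1n eqSS.
  by rewrite gtn_eqF ?mul0r // ltn_ord.
rewrite addr0 mxE /= /cofactor addn0.
rewrite (_ : row' _ _ = 1%:M) ?det1 ?mulr1 1?mulrC //.
apply/matrixP => i j; rewrite !mxE /= /bump leqNgt ltn_ord add0n.
by rewrite leq0n add1n eqSS.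
Qed.

(** The hypothesis on [d] is [q h' = d h] read coefficientwise, and it produces the first column.
    Every later column [k] of [shift_mx] is a unit vector selecting column [k - 1] of the Toeplitz
    matrix. *)
Lemma Hmx_factor h d n : h 0%N = 1 ->
    (forall i, (i < n)%N ->
      i.+1%:R * h i.+1 = \sum_(j < i.+1) d j.+1 * h (i - j)%N) ->
  Hmx h n = toeplitz_mx h n *m shift_mx d n.
Proof.
move=> h0 dP; apply/matrixP => i k; rewrite !mxE.
case: eqP => [k0 | /eqP k_neq0].
  rewrite dP // (big_ord_widen n (fun j => d j.+1 * h (i - j)%N)) //.
  rewrite big_mkcond; apply: eq_bigr => j _; rewrite !mxE k0 eqxx ltnS.
  by case: ifP => _; rewrite ?mul0r // mulrC.
have lt_k1n : (k.-1 < n)%N by apply: leq_ltn_trans (leq_pred k) (ltn_ord k).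
rewrite (bigD1 (Ordinal lt_k1n)) //= big1 ?addr0 => [|j neq_jk].
  rewrite !mxE /= (negPf k_neq0) prednK ?lt0n // eqxx mulr1.
  case: (nat_of_ord k) k_neq0 => //= k' _; rewrite subSS eqSS.
  (* On the superdiagonal the Toeplitz entry is [h 0], which gives the [1] of [Hmx]. *)
  by case: (ltngtP k' i) => // ->; rewrite subnn h0.
rewrite !mxE (negPf k_neq0); case: eqP => [jk | _]; last by rewrite mulr0.
by case/eqP: neq_jk; apply: val_inj; rewrite /= -jk.
Qed.

Lemma det_Hmx h d n : h 0%N = 1 ->
    (forall i, (i < n.+1)%N ->
      i.+1%:R * h i.+1 = \sum_(j < i.+1) d j.+1 * h (i - j)%N) ->
  \det (Hmx h n.+1) = (-1) ^+ n * d n.+1.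
Proof.
move=> h0 /(Hmx_factor h0) ->.
by rewrite det_mulmx det_toeplitz_mx // mul1r det_shift_mx.
Qed.

End Determinant.

Lemma map_Hmx (R S : nzRingType) (f : {rmorphism R -> S}) (h : nat -> R) n :
  map_mx f (Hmx h n) = Hmx (f \o h) n.
Proof.
apply/matrixP => i k; rewrite !mxE.
by do 3?case: ifP => _ //=; rewrite ?rmorphM ?rmorph_nat ?rmorph0 ?rmorph1.
Qed.

(** * Partitions with bounded parts: enumeration and recurrence *)

Section Partitions.

Local Open Scope nat_scope.

(* [f] is fuel: the result is complete as soon as [m + n < f]. *)
Fixpoint parts f m n : seq (seq nat) :=
  if f is f'.+1 then
    if m is m'.+1 then
      (if m <= n then [seq m :: s | s <- parts f' m (n - m)] else [::])
        ++ parts f' m' n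
    else if n == 0 then [:: [::]] else [::]
  else [::].

Lemma is_partition_cons n x s :
  is_partition n (x :: s) =
  [&& 0 < x, x <= n, all (geq x) s & is_partition (n - x) s].
Proof.
rewrite /is_partition /= path_sortedE; last first.
  by move=> a b c /= ? /leq_trans; apply.
rewrite inE negb_or eq_sym lt0n.
have -> : (x + sumn s == n) = (x <= n) && (sumn s == n - x).
  by apply/eqP/andP => [|[? /eqP]]; [move=> <-; split; lia | lia].
by case: (x != 0); case: all; case: (sorted _ _); case: (x <= n);
  case: (0 \notin s).
Qed.

Lemma mem_parts f m n s : m + n < f ->
  (s \in parts f m n) = is_partition n s && all (geq m) s.
Proof.
elim: f m n s => // f IHf [|m] n s; rewrite ltnS => le_mn_f.
  case: s => [|x s] /=; first by rewrite /is_partition /= eq_sym; case: eqP.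
  rewrite is_partition_cons leqn0 lt0n; case: (x == 0); case: eqP;
    by rewrite ?inE ?andbF.
rewrite [parts _ _ _]/= mem_cat IHf; last lia.
case: s => [|x s].
  case: ifP => _; rewrite ?orFb //.
  by rewrite [X in X || _](_ : _ = false) //; apply/mapP => -[].
(* Parts are in nonincreasing order, so the head is the largest part and tells the two branches of
   [parts] apart. *)
have -> : (x :: s \in (if m < n
    then [seq m.+1 :: t | t <- parts f m.+1 (n - m.+1)] else [::]))
      = (x == m.+1) && is_partition n (x :: s).
  rewrite is_partition_cons; have [-> | neq] := eqVneq x m.+1; last first.
    case: ifP => // _; apply/mapP => -[t _ [xm _]].
    by rewrite xm eqxx in neq.
  case: ifP => lt_mn //=.
  rewrite mem_map; last by move=> ? ? [].
  by rewrite IHf 1?andbC //; lia.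
rewrite /= is_partition_cons.
have [-> | neq] := eqVneq x m.+1.
  rewrite ltnn ltnSn /= andbF orbF.
  by case: (all _ s); rewrite ?andbF ?andbT.
rewrite andFb orFb (leq_eqVlt x m.+1) (negPf neq) orFb ltnS.
case le_xm: (x <= m); rewrite ?andbF //=.
case all_x: (all _ s); rewrite ?andbF //=.
rewrite !(sub_all _ all_x) // => y /= le_yx; last exact: leq_trans le_xm.
by apply: leq_trans le_yx _; apply: leqW.
Qed.

Lemma uniq_parts f m n : m + n < f -> uniq (parts f m n).
Proof.
elim: f m n => // f IHf [|m] n; rewrite ltnS => le_mn_f; first by case: n le_mn_f.
rewrite [parts _ _ _]/= cat_uniq [uniq (parts f m n)]IHf ?andbT; last lia.
apply/andP; split; first case: ifP => // lt_mn.
  by rewrite map_inj_uniq ?IHf; [|lia|move=> ? ? []].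
apply/hasPn => s; rewrite mem_parts; last lia.
case/andP => _ le_s; case: ifP => // _; apply/mapP => -[t _ st].
by move: le_s; rewrite st /= ltnn.
Qed.

Definition nparts m n := size (parts (m + n).+1 m n).

(** Any two sufficient amounts of fuel give duplicate-free lists with the same members. *)
Lemma npartsE f m n : m + n < f -> size (parts f m n) = nparts m n.
Proof.
move=> lt_mn_f; apply/perm_size/uniq_perm; rewrite ?uniq_parts // => s.
by rewrite !mem_parts.
Qed.

Lemma nparts0 n : nparts 0 n = (n == 0).
Proof. by case: n. Qed.

Lemma npartsS m n :
  nparts m.+1 n = (if m < n then nparts m.+1 (n - m.+1) else 0) + nparts m n.
Proof.
(* With fuel [f.+1], one unfolding leaves enough fuel for both recursive calls. *)
have [f lt_f] : exists f, m.+1 + n < f by exists (m.+1 + n).+1.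
rewrite -(@npartsE f.+1); last lia.
rewrite [parts _ _ _]/= size_cat [size (parts f m n)]npartsE; last lia.
by case: ifP => // lt_mn; rewrite size_map npartsE //; lia.
Qed.

Lemma is_partition_bounds n s : is_partition n s ->
  (size s <= n) && all (geq n) s.
Proof.
elim: s n => //= x s IHs n; rewrite is_partition_cons.
case/and4P=> x_gt0 le_xn all_x /IHs /andP[le_s _]; rewrite le_xn.
apply/andP; split; first lia.
by apply: sub_all all_x => y /= /leq_trans; apply.
Qed.

(** [L] is split by length: the members of length [k] match the [k]-tuples counted by [npartitions],
    since parts and length are at most [n]. *)
Lemma npartitions_enum n (L : seq (seq nat)) :
  uniq L -> L =i is_partition n -> npartitions n = size L.
Proof.
move=> uL memL; rewrite /npartitions.
have memE s : s \in L -> (size s <= n) && all (geq n) s.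
  by rewrite memL => /is_partition_bounds.
transitivity (\sum_(k < n.+1) count (fun s => size s == k) L).
  apply: eq_bigr => k _; rewrite cardE -size_filter.
  set S := [set t | _].
  rewrite -(size_map (fun t : k.-tuple 'I_n.+1 => map val t)).
  apply/perm_size/uniq_perm; rewrite ?filter_uniq //.
    rewrite map_inj_uniq ?enum_uniq // => t u /(inj_map val_inj) /val_inj //.
  move=> s; rewrite mem_filter memL.
  apply/mapP/andP => [[t] | [/eqP size_s part_s]].
    by rewrite mem_enum inE => part_t ->; rewrite size_map size_tuple.
  have /andP[_ /allP le_s] := is_partition_bounds part_s.
  have size_t : size (map (@inord n) s) == k by rewrite size_map size_s.
  have val_t : map val (map (@inord n) s) = s.
    rewrite -map_comp map_id_in // => x /le_s le_xn /=.
    by rewrite inordK.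
  by exists (Tuple size_t); rewrite ?mem_enum ?inE /= val_t.
(* After exchanging the sums, each [s] contributes once, at [k = size s]. *)
rewrite -sum1_size (eq_bigr (fun k : 'I_n.+1 => \sum_(s <- L) (size s == k))).
  rewrite exchange_big /= big_seq [RHS]big_seq; apply: eq_bigr => s.
  case/memE/andP; rewrite -ltnS => lt_sn _.
  rewrite (bigD1 (Ordinal lt_sn)) //= eqxx big1 // => k neq_k.
  by apply/eqP; rewrite eqb0 eq_sym; apply: neq_k.
by move=> k _; rewrite -sum1_count big_mkcond; apply: eq_bigr => s _; case: eqP.
Qed.

Lemma nparts_npartitions m n : n <= m -> nparts m n = npartitions n.
Proof.
move=> le_nm; symmetry; apply: npartitions_enum; first exact: uniq_parts.
move=> s; rewrite mem_parts // andb_idr // => /is_partition_bounds/andP[_].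
by apply: sub_all => x /= /leq_trans; apply.
Qed.

End Partitions.

(** * Power series identities modulo ['X^N] *)

Section PowerSeries.

Implicit Types p q : {poly rat}.

Let euler M : {poly rat} := \prod_(1 <= m < M.+1) (1 - 'X^m).

Let series N m : {poly rat} := \poly_(i < N) (nparts m i)%:R.

Lemma dvdXn_coef N p : 'X^N %| p -> forall i, (i < N)%N -> p`_i = 0.
Proof. by case/dvdpP=> q -> i lt_iN; rewrite coefMXn lt_iN. Qed.

Lemma coef_dvdXn N p : (forall i, (i < N)%N -> p`_i = 0) -> 'X^N %| p.
Proof.
move=> p0; rewrite -(poly_take_drop N p) (_ : take_poly N p = 0).
  by rewrite add0r dvdp_mull.
by apply/polyP => i; rewrite coef_take_poly coef0; case: ifP => // /p0.
Qed.

Lemma coefX_deriv p i : ('X * p^`())`_i = i%:R * p`_i.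
Proof.
by rewrite coefXM; case: i => [|i]; rewrite ?mul0r //= coef_deriv mulr_natl.
Qed.

(** The operator [q d/dq] multiplies coefficient [i] by [i], so it preserves congruence modulo
    ['X^N] with no loss of precision, and it kills the constant [1]. *)
Lemma dvdXn_mul_deriv N p q :
  'X^N %| p * q - 1 -> 'X^N %| 'X * (p^`() * q + p * q^`()).
Proof.
move=> /dvdXn_coef pq1; apply: coef_dvdXn => i lt_iN.
rewrite -derivM coefX_deriv; case: i lt_iN => [|i] lt_iN; first by rewrite mul0r.
have := pq1 _ lt_iN; rewrite coefB coef1 subr0 => ->.
by rewrite mulr0.
Qed.

(** This is the recurrence [npartsS] in generating-function form. *)
Lemma series_step N m :
  'X^N %| series N m.+1 * (1 - 'X^(m.+1)) - series N m.
Proof.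
apply: coef_dvdXn => i lt_iN; rewrite mulrBr mulr1 !coefB coefMXn !coef_poly.
rewrite lt_iN (leq_ltn_trans (leq_subr _ _) lt_iN) npartsS ltnS natrD.
by case: ltnP => _; ring.
Qed.

Lemma series_euler N m : 'X^N %| series N m * euler m - 1.
Proof.
elim: m => [|m IHm]; rewrite /euler.
  rewrite big_nil mulr1; apply: coef_dvdXn => i lt_iN.
  by rewrite coefB coef_poly coef1 lt_iN nparts0 subrr.
rewrite big_nat_recr //=.
set e := \prod_(1 <= i < m.+1) _; set x := 1 - _.
rewrite (_ : _ - 1 = (series N m.+1 * x - series N m) * e +
                     (series N m * e - 1)); last by ring.
by rewrite dvdp_addl // dvdp_mulr // series_step.
Qed.

(** The factor ['X] in [tau] accounts for the index shift, and [tau_stable] allows [N] factors for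
    every coefficient at once. *)
Lemma coef_euler24 N i : (i < N)%N -> (euler N ^+ 24)`_i = (tau i.+1)%:~R.
Proof.
move=> lt_iN; rewrite -(tau_stable lt_iN) coefXM /=.
rewrite prodrXl -(coef_map intr) rmorphXn rmorph_prod; congr (polyseq (_ ^+ _))`_i.
by apply: eq_bigr => m _; rewrite rmorphB rmorph1 /= map_polyXn.
Qed.

End PowerSeries.

Theorem theorem3p5 (n : nat) (hn : (1 <= n)%N) :
  n%:R * (npartitions n)%:R =
  \sum_(1 <= k < n.+1)
     (-1) ^+ k / 24%:R * (\det (Hmx (fun j => tau j.+1) k))%:~R
       * (npartitions (n - k))%:R :> rat.
Proof.
pose N := n.+1.
pose E : {poly rat} := \prod_(1 <= m < N.+1) (1 - 'X^m).
pose A : {poly rat} := \poly_(i < N) (nparts N i)%:R.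
(* Since [E] inverts [A] modulo ['X^N], [D] stands for [- 24 q A' / A] without any division. *)
pose D : {poly rat} := - 24%:R *: ('X * A^`() * E).
have AE1 : 'X^N %| A * E - 1 := series_euler N N.
have AE' := dvdXn_mul_deriv AE1.
have coefA i : (i < N)%N -> A`_i = (npartitions i)%:R.
  by move=> lt_iN; rewrite coef_poly lt_iN nparts_npartitions // ltnW.
have D0 : D`_0 = 0 by rewrite coefZ -mulrA coefXM mulr0.
have DA i : (i < N)%N -> (D * A)`_i = - 24%:R * (i%:R * A`_i).
  move=> lt_iN; apply/eqP; rewrite -subr_eq0; apply/eqP.
  rewrite -coefX_deriv -coefZ -coefB; apply: dvdXn_coef lt_iN.
  rewrite (_ : _ - _ = (- 24%:R *: ('X * A^`())) * (A * E - 1)).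
    exact: dvdp_mull.
  by rewrite /D -!mul_polyC; ring.
have DT i : (i < N)%N -> (D * E ^+ 24)`_i = i%:R * (E ^+ 24)`_i.
  move=> lt_iN; apply/eqP; rewrite -subr_eq0; apply/eqP.
  rewrite -coefX_deriv -coefB; apply: dvdXn_coef lt_iN.
  (* The difference is an explicit combination of the two quantities that [AE'] and [AE1] show
     divisible by ['X^N]. *)
  rewrite (_ : _ - _ = (- 24%:R * E ^+ 24) * ('X * (A^`() * E + A * E^`())) +
                       (24%:R * 'X * E^`() * E ^+ 23) * (A * E - 1)).
    by rewrite dvdp_add // dvdp_mull.
  by rewrite /D deriv_exp /= -mul_polyC polyCN polyC_natr -mulr_natl; ring.
have detH k : (k < n)%N ->
    (\det (Hmx (fun j => tau j.+1) k.+1))%:~R = (-1) ^+ k * D`_k.+1.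
  move=> lt_kn; rewrite -det_map_mx map_Hmx.
  apply: (@det_Hmx _ _ (fun i => D`_i)) => [|i lt_ik] /=.
    (* The value [tau 1] is [E ^+ 24] evaluated at [0], where each factor is [1] because
       [m >= 1]. *)
    rewrite -(@coef_euler24 N) // -horner_coef0 horner_exp horner_prod big_nat.
    rewrite big1 ?expr1n // => -[|m] // _.
    by rewrite hornerD hornerN hornerC hornerXn expr0n subr0.
  have lt_iN : (i.+1 < N)%N by rewrite ltnS; apply: leq_trans lt_ik lt_kn.
  rewrite -(coef_euler24 lt_iN) -DT // coefM big_ord_recl D0 mul0r add0r.
  apply: eq_bigr => j _; rewrite -(@coef_euler24 N) ?subSS //.
  by apply: leq_ltn_trans (leq_subr _ _) (ltnW lt_iN).
(* Coefficient [n] is the last one that the modulus ['X^N] controls; as [D0] removes the index [0],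
   the sum runs from [1] as in the statement. *)
have := DA n (ltnSn n); rewrite coefM big_ord_recl D0 mul0r add0r.
rewrite coefA // => DAn.
rewrite big_add1 /= big_mkord.
apply: (@mulfI _ (- 24%:R)); first by rewrite oppr_eq0 pnatr_eq0.
rewrite -DAn mulr_sumr; apply: eq_bigr => k _.
rewrite /= /bump /= add1n detH // coefA ?ltnS ?leq_subr // exprS.
(* The sign of the determinant cancels that of the summand up to one [-1], which the factor [- 24]
   absorbs. *)
have sign2 : (-1) ^+ k * (-1) ^+ k = 1 :> rat by rewrite -expr2 sqrr_sign.
set p := (npartitions _)%:R.
rewrite -[LHS]mul1r -mulrA -[in LHS]sign2.
by field.
Qed.
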